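(* Let $f:\mathbb{C}\to\mathbb{C}$ be a holomorphic function. Suppose that for some natural number $n$ there exist $2n+1$ functions $u,v_1,\dots,v_n,w_1,\dots,w_n:\mathbb{C}\to\mathbb{C}$ satisfying: (i) for every $m\in\{1,\dots,n\}$, $\displaystyle\lim_{h\to 0}\frac{v_m(h)}{h}=0$; (ii) for all $(x,h)\in\mathbb{C}\times\mathbb{C}$, $\displaystyle f(x+h)-f(x)=u(h)f'(x)+\sum_{m=1}^n v_m(h)w_m(x)$. Suppose moreover that there exists a summable set $\mathcal{U}$ such that $\{f,f',w_1,\dots,w_n\}\subset\mathbf{S}(\mathcal{U})$. Then, for all $x\in\mathbb{C}$, $$\frac{d}{dx}\,\Sigma_{\mathcal{U}}(f;1,x)=\mathrm{ess}(f)+\Sigma_{\mathcal{U}}(f';1,x),$$ where $\mathrm{ess}(f)$ is the essence of $f$ relative to $\mathcal{U}$.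
   Context: Sets of functions. $\mathbb{C}^{\mathbb{C}}$ is the set of all functions $\mathbb{C}\to\mathbb{C}$. For $X\subset\mathbb{C}^{\mathbb{C}}$: $\mathbf{L}(X)$ is the set of all (finite, complex) linear combinations of functions in $X$; $\mathbf{T}(X)$ is the set of all translates $x\mapsto g(x+c)$ with $g\in X$, $c\in\mathbb{C}$; and $\mathbf{S}(X):=\mathbf{L}(\mathbf{T}(X))$. Polynomial sums. For a complex polynomial $p$, let $P$ be the unique polynomial with $P(z)-P(z-1)=p(z)$ for all $z$ and $P(0)=0$; the fractional sum of $p$ from $x$ to $y$ is $P(y)-P(x-1)$, for $x,y\in\mathbb{C}$. Fractional summable functions. $f:\mathbb{C}\to\mathbb{C}$ is fractional summable if there are a degree bound $m$ and a sequence $(p_n)_{n\in\mathbb{N}}$ of polynomials of degree $\le m$ (the null polynomial has degree $-\infty$) such that $|f(n+x)-p_n(n+x)|\to 0$ as $n\to\infty$ for all $x\in\mathbb{C}$, and such that for all $x,y\in\mathbb{C}$ the limit as $n\to\infty$ of (fractional sum of $p_n$ from $n+x$ to $n+y$) $+\sum_{\nu=1}^n\bigl(f(\nu+x-1)-f(\nu+y)\bigr)$ exists. $\mathcal{F}$ is the set of functions $\mathbb{C}\to\mathbb{C}$ that are linear combinations of holomorphic (entire) functions and fractional summable functions. Summable sets. A set $\mathcal{U}\subset\mathcal{F}$ is a summable set if there is a unique map $\Sigma_{\mathcal{U}}:\mathbf{S}(\mathcal{U})\times\mathbb{C}^2\to\mathbb{C}$, $(f,x,y)\mapsto\Sigma_{\mathcal{U}}(f;x,y)$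 (thought of as ''$\sum_{k=x}^y f(k)$''), satisfying, for all $f,g\in\mathbf{S}(\mathcal{U})$ and $x,y,z,s,\lambda,\mu\in\mathbb{C}$: (A1) $\Sigma_{\mathcal{U}}(f;x,y)+\Sigma_{\mathcal{U}}(f;y+1,z)=\Sigma_{\mathcal{U}}(f;x,z)$; (A2) $\Sigma_{\mathcal{U}}(f;x+s,y+s)=\Sigma_{\mathcal{U}}(h;x,y)$ where $h(t)=f(t+s)$; (A3) $\Sigma_{\mathcal{U}}(\lambda f+\mu g;x,y)=\lambda\Sigma_{\mathcal{U}}(f;x,y)+\mu\Sigma_{\mathcal{U}}(g;x,y)$; (A4) $\Sigma_{\mathcal{U}}(f;1,1)=f(1)$; (A5* ) if $f$ is holomorphic, then $x\mapsto\Sigma_{\mathcal{U}}(f;1,x)$ is holomorphic on $\mathbb{C}$; (A6) if $\lim_{n\to\infty}f(t+n)=0$ for every $t\in\mathbb{C}$, then $\lim_{n\to\infty}\Sigma_{\mathcal{U}}(f(\cdot+n);x,y)=0$; moreover, if there is a sequence $(p_n)$ of polynomials of fixed degree (independent of $n$) with $|f(t+n)-p_n(t+n)|\to0$ for all $t\in\mathbb{C}$, then $\Sigma_{\mathcal{U}}(f(\cdot+n);x,y)$ minus the fractional sum of the polynomial $p_n(\cdot+n)$ from $x$ to $y$ tends to $0$ as $n\to\infty$. The map $\Sigma_{\mathcal{U}}$ is called the fractional sum relative to $\mathcal{U}$. Essence. For $f\in\mathbf{S}(\mathcal{U})$, the essence of $f$ relative to $\mathcal{U}$ is $\mathrm{ess}(f):=\lim_{h\to0}\frac1h\Sigma_{\mathcal{U}}(f;1,h)$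 ($h\in\mathbb{C}\setminus\{0\}$), if the limit exists; then $f$ is said to be a function with essence in $\mathcal{U}$. *)

(* Defs.v *)
From HB Require Import structures.
From mathcomp Require Import all_boot all_order all_algebra.
From mathcomp Require Import complex.
From mathcomp Require Import all_classical all_reals all_analysis.

Set Implicit Arguments.
Unset Strict Implicit.
Unset Printing Implicit Defensive.

Import Order.TTheory GRing.Theory Num.Theory.
Import numFieldNormedType.Exports.

Local Open Scope classical_set_scope.
Local Open Scope ring_scope.

(* R[i] bundled as a numClosedFieldType, so that it carries the topology and
   the normed module structure (over itself) that MathComp-Analysis attaches to
   every numClosedFieldType; derivatives are then complex derivatives. *)
Definition Cplx (R : realType) : numClosedFieldType := R[i].

Section FractionalSums.
Variable R : realType.
Local Notation C := (Cplx R).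
Implicit Types (f g : C -> C) (p P : {poly C}) (X U : set (C -> C)).

Definition holomorphic f := forall z : C, derivable f z 1.

Definition lin_span X : set (C -> C) :=
  [set f | exists (n : nat) (a : 'I_n -> C) (g : 'I_n -> C -> C),
     (forall i, X (g i)) /\ (forall x, f x = \sum_(i < n) a i * g i x)].

Definition translates X : set (C -> C) :=
  [set f | exists g (c : C), X g /\ (forall x, f x = g (x + c))].

Definition trans_span X : set (C -> C) := lin_span (translates X).

Definition is_antidiff p P := P.[0] = 0 /\ forall z, P.[z] - P.[z - 1] = p.[z].

Definition antidiff p : {poly C} := xget 0 [set P | is_antidiff p P].

Lemma antidiff_uniq p P Q : is_antidiff p P -> is_antidiff p Q -> P = Q.
Proof.
move=> [P0 dP] [Q0 dQ]; apply/eqP; rewrite -subr_eq0; apply/eqP.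
set D := P - Q.
have Dn (n : nat) : D.[n%:R] = 0.
  elim: n => [|n IHn]; first by rewrite /D !hornerE P0 Q0 subrr.
  have := dP n.+1%:R; have := dQ n.+1%:R; rewrite -natr1 addrK => <- /eqP.
  rewrite subr_eq => /eqP PE; move: IHn; rewrite /D !hornerE.
  move/eqP; rewrite subr_eq0 => /eqP En.
  by rewrite PE En addrNK subrr.
pose rs := [seq n%:R | n <- iota 0 (size D)] : seq C.
have rsD : all (root D) rs by apply/allP => _ /mapP[n _ ->]; apply/eqP/Dn.
have urs : uniq rs by rewrite map_inj_uniq ?iota_uniq//; exact: mulrIn (oner_neq0 _).
by apply: (roots_geq_poly_eq0 rsD urs); rewrite size_map size_iota.
Qed.

Lemma antidiff_exists p : exists P, is_antidiff p P.
Proof.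
have [n] := ubnP (size p); elim: n p => // n IHn p; rewrite ltnS => sp.
have [->|p0] := eqVneq p 0.
  by exists 0; split=> [|z]; rewrite !horner0// subrr.
pose k := (size p).-1; have kE : size p = k.+1 by rewrite prednK// size_poly_gt0.
pose c : C := lead_coef p / k.+1%:R.
pose d : {poly C} := 'X^(k.+1) - ('X - 1%:P) ^+ k.+1.
have dE : d = \sum_(i < k.+1) ('X - 1%:P) ^+ i * 'X^(k - i).
  rewrite /d subrXX opprB addrCA subrr addr0 mul1r.
  by apply: eq_bigr => i _; rewrite mulrC.
have sX j : size (('X - 1%:P : {poly C}) ^+ j) = j.+1 by rewrite size_exp_XsubC.
have mX j : lead_coef (('X - 1%:P : {poly C}) ^+ j) = 1.
  by rewrite lead_coef_exp lead_coefXsubC expr1n.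
have st (i : 'I_k.+1) : size (('X - 1%:P : {poly C}) ^+ i * 'X^(k - i)) = k.+1.
  rewrite size_mulXn ?sX; last by rewrite -size_poly_gt0 sX.
  by rewrite addnS subnK// -ltnS.
have sd : (size d <= k.+1)%N.
  by rewrite dE; apply: (leq_trans (size_sum _ _ _)); apply/bigmax_leqP => i _; rewrite st.
have dk : d`_k = k.+1%:R.
  rewrite dE coef_sum (eq_bigr (fun=> 1)) ?sumr_const ?card_ord// => i _.
  have : lead_coef (('X - 1%:P : {poly C}) ^+ i * 'X^(k - i)) = 1.
    by rewrite lead_coefM mX lead_coefXn mulr1.
  by rewrite lead_coefE st.
have [|Q [Q0 dQ]] := IHn (p - c *: d).
  apply: leq_trans sp; rewrite kE ltnS; apply/leq_sizeP => j.
  rewrite leq_eqVlt => /predU1P[<-|kj].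
    by rewrite coefB coefZ dk /c divfK ?pnatr_eq0// lead_coefE kE subrr.
  rewrite coefB coefZ !nth_default ?mulr0 ?subr0//; last by rewrite kE.
  exact: leq_trans sd kj.
exists (Q + c *: 'X^(k.+1)); split=> [|z].
  by rewrite !hornerE Q0 expr0n mulr0 addr0.
have := dQ z; rewrite /d !hornerE => /eqP.
rewrite eq_sym subr_eq => /eqP ->.
by rewrite mulrBr opprD addrACA.
Qed.

Definition polysum p (x y : C) : C := (antidiff p).[y] - (antidiff p).[x - 1].

(* The degrees of the p n are bounded independently of n; p n = 0 is allowed. *)
Definition approx_poly f (p : nat -> {poly C}) :=
  (exists m : nat, forall n, (size (p n) <= m.+1)%N) /\
  (forall x : C, `|f (n%:R + x) - (p n).[n%:R + x]| @[n --> \oo] --> (0 : C)).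

Definition fractional_summable f :=
  exists p : nat -> {poly C}, approx_poly f p /\
    forall x y : C, cvgn (fun n : nat =>
      polysum (p n) (n%:R + x) (n%:R + y) +
      \sum_(1 <= k < n.+1) (f (k%:R + x - 1) - f (k%:R + y))).

Definition calF : set (C -> C) :=
  lin_span (holomorphic `|` fractional_summable).

(* A map on trans_span U * C^2 is encoded as a total function whose values
   outside trans_span U are irrelevant. *)
Record is_fracsum U (Sig : (C -> C) -> C -> C -> C) : Prop := IsFracsum {
  fracsum_chasles : forall f x y z, trans_span U f ->
    Sig f x y + Sig f (y + 1) z = Sig f x z ;
  fracsum_shift : forall f x y s, trans_span U f ->
    Sig f (x + s) (y + s) = Sig (fun t => f (t + s)) x y ;
  fracsum_linear : forall f g (a b : C) x y,
    trans_span U f -> trans_span U g ->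
    Sig (fun t => a * f t + b * g t) x y = a * Sig f x y + b * Sig g x y ;
  fracsum_one : forall f, trans_span U f -> Sig f 1 1 = f 1 ;
  fracsum_holomorphic : forall f, trans_span U f ->
    holomorphic f -> holomorphic (Sig f 1) ;
  fracsum_cvg0 : forall f x y, trans_span U f ->
    (forall t : C, f (t + n%:R) @[n --> \oo] --> (0 : C)) ->
    Sig (fun t => f (t + n%:R)) x y @[n --> \oo] --> (0 : C) ;
  fracsum_cvg_poly : forall f (p : nat -> {poly C}) x y, trans_span U f ->
    approx_poly f p ->
    Sig (fun t => f (t + n%:R)) x y - polysum (p n \Po ('X + n%:R%:P)) x y
      @[n --> \oo] --> (0 : C)
}.

Definition summable_set U :=
  [/\ U `<=` calF,
      exists Sig, is_fracsum U Sig &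
      forall Sig1 Sig2, is_fracsum U Sig1 -> is_fracsum U Sig2 ->
        forall f x y, trans_span U f -> Sig1 f x y = Sig2 f x y].

(* Meaningful when U is summable, and then determined on trans_span U. *)
Definition fracsum U : (C -> C) -> C -> C -> C :=
  xget (fun _ _ _ => 0) [set Sig | is_fracsum U Sig].

Definition ess_quotient U f (h : C) : C := h^-1 * fracsum U f 1 h.

Definition has_essence U f := cvg (ess_quotient U f h @[h --> (0 : C)^']).

Definition ess U f : C := lim (ess_quotient U f h @[h --> (0 : C)^']).

End FractionalSums.

(* Main.v *)
Require Import Defs.
From HB Require Import structures.
From mathcomp Require Import all_boot all_order all_algebra.
From mathcomp Require Import complex.
From mathcomp Require Import all_classical all_reals all_analysis.
Import Order.TTheory GRing.Theory Num.Theory.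
Import numFieldNormedType.Exports.
Local Open Scope classical_set_scope.
Local Open Scope ring_scope.

(* Chasles and shift give, for F := Sig f 1,
     F (x + h) - F x = Sig f 1 h + Sig (f (. + h) - f) 1 x
                     = Sig f 1 h + u h * Sig f' 1 x + \sum_m v m h * Sig (w m) 1 x.
   After division by h the first term tends to F'(0), which exists because F is
   holomorphic and F 0 = 0, and the last sum tends to 0. If f' x0 != 0 for some
   x0, the hypothesis at x0 forces u h / h --> 1; otherwise f' = 0 and the
   middle term vanishes. *)

Section FractionalSumDerivative.
Variable R : realType.
Local Notation C := (Cplx R).
Implicit Types (f g : C -> C) (X U : set (C -> C)).

Lemma lin_span_lin X f g (a b : C) : lin_span X f -> lin_span X g ->
  lin_span X (fun t => a * f t + b * g t).
Proof.
move=> [n1 [a1 [g1 [Xg1 fE]]]] [n2 [a2 [g2 [Xg2 gE]]]].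
exists (n1 + n2)%N.
exists (fun i => match fintype.split i with inl j => a * a1 j | inr j => b * a2 j end).
exists (fun i => match fintype.split i with inl j => g1 j | inr j => g2 j end).
split=> [i|x]; first by case: (fintype.split i).
rewrite big_split_ord/= fE gE !mulr_sumr; congr (_ + _); apply: eq_bigr => i _.
  by rewrite (unsplitK (inl i : 'I_n1 + 'I_n2)) mulrA.
by rewrite (unsplitK (inr i : 'I_n1 + 'I_n2)) mulrA.
Qed.

Lemma trans_span_shift U f (s : C) : trans_span U f ->
  trans_span U (fun t => f (t + s)).
Proof.
move=> [n [a [g [tg fE]]]]; exists n, a, (fun i t => g i (t + s)).
split=> [i|x]; last exact: fE.
have [g0 [c [Ug0 gE]]] := tg i; exists g0, (s + c); split=> // x.
by rewrite gE addrA.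
Qed.

(** [derivable] uses scaling by h^-1 and the direction h *: 1; over the field itself both scalings
    are products. *)
Lemma derivable_cvg_quotient f (x : C) : derivable f x 1 ->
  (f (x + h) - f x) / h @[h --> (0 : C)^'] --> 'D_1 f x.
Proof.
move=> df; apply: cvg_trans df; apply: near_eq_cvg; near=> h.
by rewrite /= [h *: 1]mulr1 [_ *: (_ - _)]mulrC [h + x]addrC.
Unshelve. all: by end_near. Qed.

Lemma cvg_quotient_is_derive f (x l : C) :
  (f (x + h) - f x) / h @[h --> (0 : C)^'] --> l -> is_derive x 1 f l.
Proof.
move=> fl.
have fl' : h^-1 *: ((f \o shift x) (h *: 1) - f x) @[h --> (0 : C)^'] --> l.
  apply: cvg_trans fl; apply: near_eq_cvg; near=> h.
  by rewrite /= [h *: 1]mulr1 [_ *: (_ - _)]mulrC [h + x]addrC.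
apply: DeriveDef; first by apply/cvg_ex; exists l.
exact/cvg_lim.
Unshelve. all: by end_near. Qed.

Section FracsumTheory.
Variables (U : set (C -> C)) (Sig : (C -> C) -> C -> C -> C).
Hypothesis SigP : is_fracsum U Sig.

(** Chasles at 1, 0, 1 adds this term to [Sig f 1 1] and returns [Sig f 1 1]. It makes
    [ess_quotient] a difference quotient at 0. *)
Lemma fracsum_from1_to0 f : trans_span U f -> Sig f 1 0 = 0.
Proof.
move=> Uf; have := fracsum_chasles SigP 1 0 1 Uf.
by rewrite add0r => /(canRL (addrK _)) ->; rewrite subrr.
Qed.

Lemma fracsum_null f x y : trans_span U f -> (forall t, f t = 0) ->
  Sig f x y = 0.
Proof.
move=> Uf f0; have := fracsum_linear SigP 0 0 x y Uf Uf.
rewrite !mul0r addr0 => <-; congr (Sig _ x y).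
by apply/funext => t; rewrite f0 !mul0r addr0.
Qed.

(** Membership and value go through one induction, because linearity of [Sig] applies only to
    functions known to lie in the span. The extra summand [f] makes the empty sum trivial. *)
Lemma fracsum_add_sum n (a : 'I_n -> C) (g : 'I_n -> C -> C) f :
  trans_span U f -> (forall i, trans_span U (g i)) ->
  trans_span U (fun t => f t + \sum_(i < n) a i * g i t) /\
  forall x y, Sig (fun t => f t + \sum_(i < n) a i * g i t) x y =
    Sig f x y + \sum_(i < n) a i * Sig (g i) x y.
Proof.
move=> Uf; elim: n a g => [|n IHn] a g Ug.
  have -> : (fun t => f t + \sum_(i < 0) a i * g i t) = f.
    by apply/funext => t; rewrite big_ord0 addr0.
  by split=> // x y; rewrite big_ord0 addr0.
(* [lift ord_max] runs over all indices but the last; [wl] matches it with the [widen_ord] coming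
   from [big_ord_recr]. *)
have [Us SigE] := IHn (a \o lift ord_max) (g \o lift ord_max) (fun=> Ug _).
have wl (i : 'I_n) : widen_ord (leqnSn n) i = lift ord_max i.
  by apply/val_inj; rewrite /= /bump leqNgt ltn_ord.
have -> : (fun t => f t + \sum_(i < n.+1) a i * g i t) = (fun t =>
    1 * (f t + \sum_(i < n) (a \o lift ord_max) i * (g \o lift ord_max) i t)
    + a ord_max * g ord_max t).
  apply/funext => t; rewrite big_ord_recr mul1r addrA /=; congr (_ + _ + _).
  by apply: eq_bigr => i _; rewrite wl.
split=> [|x y]; first exact: (lin_span_lin _ _ _ _ _ Us (Ug _)).
rewrite (fracsum_linear SigP)// SigE mul1r big_ord_recr addrA /=.
by congr (_ + _ + _); apply: eq_bigr => i _; rewrite wl.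
Qed.

Lemma fracsum_increment f x h : trans_span U f ->
  Sig f 1 (x + h) - Sig f 1 x = Sig f 1 h + Sig (fun t => f (t + h) - f t) 1 x.
Proof.
(* Splitting at h leaves a sum from 1 + h to x + h, which the shift by h turns into a sum from 1 to
   x. *)
move=> Uf; rewrite -(fracsum_chasles SigP 1 h (x + h) Uf) [h + 1]addrC.
rewrite (fracsum_shift SigP)// -addrA; congr (_ + _).
have -> : (fun t => f (t + h) - f t) = (fun t => 1 * f (t + h) + (-1) * f t).
  by apply/funext => t; rewrite mul1r mulN1r.
by rewrite (fracsum_linear SigP)// ?mul1r ?mulN1r//; exact: trans_span_shift.
Qed.

End FracsumTheory.

End FractionalSumDerivative.

Theorem theorem4p3p1 (R : realType) (f : Cplx R -> Cplx R)
    (hf : holomorphic f)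
    (n : nat) (u : Cplx R -> Cplx R) (v w : 'I_n -> Cplx R -> Cplx R)
    (hv : forall m : 'I_n, v m h / h @[h --> (0 : Cplx R)^'] --> (0 : Cplx R))
    (hfx : forall x h : Cplx R,
       f (x + h) - f x = u h * derive1 f x + \sum_(m < n) v m h * w m x)
    (U : set (Cplx R -> Cplx R)) (hU : summable_set U)
    (hfU : trans_span U f) (hf'U : trans_span U (derive1 f))
    (hwU : forall m : 'I_n, trans_span U (w m)) :
  has_essence U f /\
  forall x : Cplx R,
    is_derive x 1 (fun y => fracsum U f 1 y)
      (ess U f + fracsum U (derive1 f) 1 x).
Proof.
have SigP : is_fracsum U (fracsum U) by case: hU => _ /xgetPex H _; exact: H.
have essE : ess_quotient U f h @[h --> (0 : Cplx R)^'] -->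
    'D_1 (fracsum U f 1) (0 : Cplx R).
  have hF : holomorphic (fracsum U f 1) := fracsum_holomorphic SigP hfU hf.
  have := derivable_cvg_quotient _ _ _ (hF 0).
  rewrite (fracsum_from1_to0 _ _ _ SigP)//.
  by under eq_cvg => h do rewrite add0r subr0 mulrC.
have has_ess : has_essence U f by apply/cvg_ex; eexists; exact: essE.
split; first exact: has_ess.
move=> x; apply: cvg_quotient_is_derive.
(* The coefficients are arbitrary since two families occur: the values of [w m] at [x0] and the sums
   of [w m] from 1 to x. *)
have sum0 (c : 'I_n -> Cplx R) :
    \sum_(m < n) v m h / h * c m @[h --> (0 : Cplx R)^'] --> (0 : Cplx R).
  rewrite [X in _ --> X](_ : _ = \sum_(m < n) 0 * c m).
    apply: cvg_big => [|m _]; first exact: add_continuous.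
    by apply: cvgMr_tmp; exact: hv.
  by rewrite big1// => m _; rewrite mul0r.
have uh : u h / h * fracsum U (derive1 f) 1 x @[h --> (0 : Cplx R)^'] -->
    fracsum U (derive1 f) 1 x.
  have [f'0|/existsNP[x0 /eqP f'x0]] := pselect (forall t, derive1 f t = 0).
    rewrite (fracsum_null _ _ _ SigP _ _ _ hf'U f'0).
    by under eq_cvg do rewrite mulr0; exact: cvg_cst.
  rewrite -[X in _ --> X]mul1r; apply: cvgMr_tmp.
  (* The limit 1 is written as f'(x0) / f'(x0): solving the hypothesis at [x0] for u h / h gives the
     expression in [quo] divided by f'(x0). *)
  rewrite -(divff f'x0).
  have quo : (f (x0 + h) - f x0) / h - \sum_(m < n) v m h / h * w m x0
      @[h --> (0 : Cplx R)^'] --> derive1 f x0.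
    have := derivable_cvg_quotient _ _ _ (hf x0); rewrite -derive1E => df.
    by rewrite -[X in _ --> X]subr0; apply: (cvgB df (sum0 (fun m => w m x0))).
  rewrite [X in _ --> X]mulrC.
  apply: cvg_trans (cvgMl_tmp (a := (derive1 f x0)^-1) quo); apply: near_eq_cvg; near=> h.
  rewrite /= hfx mulrDl mulr_suml.
  under [X in _ + X - _]eq_bigr do rewrite mulrAC.
  by rewrite addrK [u h * _]mulrC -mulrA mulKf.
rewrite -[X in _ --> X]addr0.
(* [has_ess] serves here as convergence of the quotient to its [lim], which is [ess U f]. *)
apply: cvg_trans
  (cvgD (cvgD has_ess uh) (sum0 (fun m => fracsum U (w m) 1 x))).
apply: near_eq_cvg; near=> h.
have -> : fracsum U f 1 (x + h) - fracsum U f 1 x = fracsum U f 1 h +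
    (u h * fracsum U (derive1 f) 1 x + \sum_(m < n) v m h * fracsum U (w m) 1 x).
  rewrite (fracsum_increment _ _ _ SigP)//; congr (_ + _).
  (* The multiple u h * f' is padded with 0 * f' to fit the two-term form of linearity. *)
  have Uf' := lin_span_lin _ _ _ _ (u h) 0 hf'U hf'U.
  have [_ SigE] := fracsum_add_sum _ _ _ SigP _ (fun m => v m h) _ _ Uf' hwU.
  rewrite -[u h * _]addr0 -[X in _ + X + _](mul0r (fracsum U (derive1 f) 1 x)).
  rewrite -(fracsum_linear SigP)// -SigE; congr (fracsum U _ 1 x).
  by apply/funext => t; rewrite hfx mul0r addr0.
rewrite mulrDl mulrDl mulr_suml addrA.
congr (_ + _ + _); [exact: mulrC|by rewrite mulrAC|].
by apply: eq_bigr => m _; rewrite mulrAC.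
Unshelve. all: by end_near. Qed.
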